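(* Let $L$ be a finite lattice that is not a chain. Then there exist two non-isomorphic transversal matroids that have the same configuration and whose lattices of cyclic flats are both isomorphic to $L$.
   Context: A cyclic flat of a matroid is a flat that is a (possibly empty) union of circuits; the cyclic flats form a lattice $\mathcal{Z}(M)$ under inclusion. A transversal matroid is one whose independent sets are the partial transversals of some finite family of sets $(A_1,\ldots,A_r)$ (sets $I$ admitting an injection $\phi:I\to[r]$ with $e\in A_{\phi(e)}$). Matroids $M,N$ have the same configuration if $|E(M)|=|E(N)|$ and there is a lattice isomorphism $\Phi:\mathcal{Z}(M)\to\mathcal{Z}(N)$ with $|\Phi(F)|=|F|$ and $r_N(\Phi(F))=r_M(F)$ for all $F$. *)

(* Defs.v *)
From HB Require Import structures.
From mathcomp Require Import all_boot all_order.

Set Implicit Arguments.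
Unset Strict Implicit.
Unset Printing Implicit Defensive.

(* The ground set of a matroid is the whole finite type E. *)
Record matroid (E : finType) := Matroid {
  indep : {set {set E}};
  indep0 : set0 \in indep;
  indepS : forall I J : {set E}, I \subset J -> J \in indep -> I \in indep;
  indep_aug : forall I J : {set E}, I \in indep -> J \in indep -> #|I| < #|J| ->
    exists2 e, e \in J :\: I & e |: I \in indep
}.

Section CyclicFlats.
Variables (E : finType) (M : matroid E).

Definition rank (A : {set E}) : nat :=
  \max_(I in indep M | I \subset A) #|I|.

Definition circuit (C : {set E}) : bool :=
  minset (fun A : {set E} => A \notin indep M) C.

Definition flat (F : {set E}) : bool :=
  [forall e, (e \notin F) ==> (rank F < rank (e |: F))].

Definition cyclic (A : {set E}) : bool :=
  [exists P : {set {set E}}, [forall C in P, circuit C] && (A == cover P)].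

Definition cyclic_flat (F : {set E}) : bool := flat F && cyclic F.

Record cflat := CFlat { cfset :> {set E}; _ : cyclic_flat cfset }.

HB.instance Definition _ := [isSub for cfset].
HB.instance Definition _ := [Finite of cflat by <:].

Definition cflat_le (F G : cflat) : bool := F \subset G.

Lemma cflat_le_refl : reflexive cflat_le.
Proof. by move=> F; apply: subxx. Qed.

Lemma cflat_le_anti : antisymmetric cflat_le.
Proof. by move=> F G FG; apply/val_inj/eqP; rewrite eqEsubset. Qed.

Lemma cflat_le_trans : transitive cflat_le.
Proof. by move=> G F H; apply: subset_trans. Qed.

HB.instance Definition _ :=
  Order.Le_isPOrder.Build Order.SetSubsetOrder.subset_display cflat
    cflat_le_refl cflat_le_anti cflat_le_trans.

End CyclicFlats.

(* Isomorphisms of lattices are taken as isomorphisms of the underlying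
   posets; such a map preserves all existing meets and joins. *)
Definition lattice_isomorphism (d d' : Order.disp_t)
    (P : porderType d) (Q : porderType d') (f : P -> Q) : Prop :=
  bijective f /\ {mono f : x y / x <= y}%O.

Definition lattice_isomorphic (d d' : Order.disp_t)
    (P : porderType d) (Q : porderType d') : Prop :=
  exists f : P -> Q, lattice_isomorphism f.

Definition matroid_isomorphic (E E' : finType)
    (M : matroid E) (N : matroid E') : Prop :=
  exists2 f : E -> E', bijective f &
    forall I : {set E}, (f @: I \in indep N) = (I \in indep M).

Definition same_configuration (E E' : finType)
    (M : matroid E) (N : matroid E') : Prop :=
  #|E| = #|E'| /\
  exists2 Phi : cflat M -> cflat N, lattice_isomorphism Phi &
    forall F : cflat M,
      #|(Phi F : {set E'})| = #|(F : {set E})| /\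
      rank N (Phi F) = rank M F.

(* The matching is a function on I only, so that r = 0 is allowed. *)
Definition partial_transversal (E : finType) (r : nat)
    (A : 'I_r -> {set E}) (I : {set E}) : Prop :=
  exists2 phi : {e : E | e \in I} -> 'I_r, injective phi &
    forall e, val e \in A (phi e).

Definition transversal_matroid (E : finType) (M : matroid E) : Prop :=
  exists (r : nat) (A : 'I_r -> {set E}),
    forall I : {set E}, I \in indep M <-> partial_transversal A I.

(* Main.v *)
(* Send x in L to the set U_x of the m in L with x not below m; this turns joins
   into unions and is an order embedding. Putting more than |L| generic elements
   on each face U_x of a simplex with vertex set L gives a transversal matroid
   whose cyclic flats are the sets F_x of elements supported in U_x, with F_x of
   rank |U_x|. For incomparable a and b, add two more elements: supported on U_a
   and U_b in one matroid, on U_a :&: U_b and U_(a join b) in the other. An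
   element supported on U_a :&: U_b lies in F_x exactly when a <= x or b <= x, so
   the sizes and ranks of the F_x agree. The sum over all elements of the squared
   number of cyclic flats containing it differs: writing A and B for the up-sets
   of a and b, |A :|: B|^2 + |A :&: B|^2 > |A|^2 + |B|^2. *)
Require Import Defs.
From mathcomp Require Import all_boot all_order.
From mathcomp Require Import zify.

Set Implicit Arguments.
Unset Strict Implicit.
Unset Printing Implicit Defensive.

Lemma exists_subset_card (E : finType) (A : {set E}) k : k <= #|A| ->
  exists2 B : {set E}, B \subset A & #|B| = k.
Proof.
move=> kA; exists [set:: take k (enum A)].
  by apply/subsetP => e; rewrite inE => /mem_take; rewrite mem_enum.
rewrite cardsE (card_uniqP _) ?take_uniq ?enum_uniq //.
by rewrite size_takel // -cardE.
Qed.

(** * Independence and flats in an arbitrary matroid *)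

Section Matroid.
Variables (E : finType) (M : matroid E).
Implicit Types (A B I F : {set E}) (e : E).

Lemma indep_rank I A : I \in indep M -> I \subset A -> #|I| <= rank M A.
Proof. by move=> iI IA; apply: leq_bigmax_cond; rewrite iI. Qed.

Lemma rank_witness A :
  exists I, [/\ I \in indep M, I \subset A & #|I| = rank M A].
Proof.
have := @eq_bigmax_cond _ [pred I in indep M | I \subset A] (fun I => #|I|).
case.
  by apply/card_gt0P; exists set0; rewrite inE indep0 sub0set.
by move=> I /andP[iI IA] eI; exists I.
Qed.

(** Extend [I] to a maximal independent [B] inside [F]. Since [e] raises the rank, some element of a
    larger independent set in [e |: F] augments [B]; by maximality it is not in [F], so it is
    [e]. *)
Lemma flat_indepU1 F I e : flat M F -> I \subset F -> I \in indep M ->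
  e \notin F -> e |: I \in indep M.
Proof.
move=> /forallP/(_ e)/implyP flF IF iI eF.
have {}flF := flF eF.
pose P J := [&& J \in indep M & J \subset F].
have [|B /maxsetP[/andP[iB BF] Bmax] IB] := @maxset_exists _ P I.
  by rewrite /P iI.
have [J [iJ JeF Jrk]] := rank_witness (e |: F).
have [|x /setDP[xJ xB] ixB] := indep_aug iB iJ.
  by rewrite Jrk; apply: leq_ltn_trans flF; apply: indep_rank.
have xe : x = e.
  have := subsetP JeF _ xJ; rewrite !inE => /orP[/eqP //|xF].
  have /Bmax : P (x |: B) by rewrite /P ixB subUset sub1set xF.
  by move=> /(_ (subsetUr _ _)) xBB; rewrite -xBB setU11 in xB.
by apply: indepS ixB; rewrite xe setUS.
Qed.

Lemma cyclicP A :
  reflect (forall e, e \in A ->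
             exists C, [/\ circuit M C, C \subset A & e \in C])
          (cyclic M A).
Proof.
apply: (iffP existsP) => [[P /andP[/forall_inP circP /eqP ->]] e|h].
  by case/bigcupP => C CP eC; exists C; rewrite circP ?bigcup_sup.
exists [set C : {set E} | circuit M C & C \subset A]; apply/andP; split.
  by apply/forall_inP => C; rewrite inE => /andP[].
apply/eqP/setP => e; apply/idP/bigcupP => [/h[C [Cc CA eC]]|[C]].
  by exists C; rewrite ?inE ?Cc.
by rewrite inE => /andP[_ /subsetP CA /CA].
Qed.

(** The isomorphism invariant that separates the two matroids, through the sum of its squares. *)
Definition cflat_count e := #|[set F | cyclic_flat M F & e \in F]|.

End Matroid.

(** * Hall's theorem and augmentation for Hall's condition *)

Section Hall.
Variables (E V : finType).
Implicit Types (S : E -> {set V}) (I J K : {set E}) (e : E).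

Definition nbr S J : {set V} := \bigcup_(e in J) S e.

Lemma nbr0 S : nbr S set0 = set0.
Proof. exact: big_set0. Qed.

Lemma nbr1 S e : nbr S [set e] = S e.
Proof. exact: big_set1. Qed.

Lemma nbrU S I J : nbr S (I :|: J) = nbr S I :|: nbr S J.
Proof. exact: bigcup_setU. Qed.

Lemma nbrS S I J : I \subset J -> nbr S I \subset nbr S J.
Proof.
move=> IJ; apply/bigcupsP => e eI.
by apply: bigcup_sup; apply: (subsetP IJ).
Qed.

Lemma sub_nbr S e J : e \in J -> S e \subset nbr S J.
Proof. by move=> eJ; apply: bigcup_sup. Qed.

(* Independence is defined by Hall's condition, which is easier to handle than
   matchings; [hall_transversal] shows that the two agree. *)
Definition hall S I := [forall J : {set E}, (J \subset I) ==> (#|J| <= #|nbr S J|)].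

Lemma hallP S I :
  reflect (forall J, J \subset I -> #|J| <= #|nbr S J|) (hall S I).
Proof. by apply: (iffP forallP) => h J; apply/implyP/h. Qed.

Lemma hallS S I J : I \subset J -> hall S J -> hall S I.
Proof.
move=> IJ /hallP h; apply/hallP => K KI.
by apply: h; apply: subset_trans IJ.
Qed.

Lemma hall0 S : hall S set0.
Proof. by apply/hallP => J; rewrite subset0 => /eqP ->; rewrite cards0. Qed.

(** Induction on [#|I|]. If a nonempty proper subset [J] is tight, match [J] first and the rest
    outside the neighbours of [J]. Otherwise every nonempty proper subset has a spare neighbour, so
    any [e0] may take any [v] in its support. [v0] is a default value that makes the matching
    total. *)
Lemma hall_matching S I (v0 : V) : hall S I ->
  exists2 f : E -> V, {in I &, injective f} & {in I, forall e, f e \in S e}.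
Proof.
move=> +; have [k] := ubnP #|I|; elim: k S I => // k IH S I Ik /hallP h.
have [->|[e0 e0I]] := set_0Vmem I.
  by exists (fun=> v0) => e; rewrite inE.
have [/existsP[J /and4P[JI J0 JneI tightJ]]|/existsPn loose] :=
  boolP [exists J : {set E},
    [&& J \subset I, J != set0, J != I & #|nbr S J| == #|J|]].
- have JpI : #|J| < #|I| by apply: proper_card; rewrite properEneq JneI.
  have [||f fi fS] := IH S J; first by lia.
    by apply/hallP => K KJ; apply/h/(subset_trans KJ).
  have [||g gi gS] := IH (fun e => S e :\: nbr S J) (I :\: J).
  + rewrite cardsD (setIidPr JI); move: J0; rewrite -card_gt0; lia.
  + apply/hallP => K; rewrite subsetD => /andP[KI KJ].
    have -> : nbr (fun e => S e :\: nbr S J) K = nbr S K :\: nbr S J.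
      apply/setP => v; rewrite inE; apply/bigcupP/andP.
        by case=> e eK /setDP[vS ->]; split=> //; apply/bigcupP; exists e.
      by case=> vJ /bigcupP[e eK vS]; exists e => //; rewrite inE vJ.
    (* Hall's condition for [K :|: J], less the tight set [J], leaves Hall's condition for [K] in
       the reduced supports. *)
    have := h (K :|: J); rewrite subUset KI JI nbrU => /(_ isT).
    rewrite !cardsU (disjoint_setI0 KJ) cards0 cardsD (eqP tightJ).
    have := subset_leq_card (subsetIl (nbr S K) (nbr S J)); lia.
  exists (fun e => if e \in J then f e else g e).
    have disj x y : x \in J -> y \in I -> y \notin J -> f x = g y -> x = y.
      move=> xJ yI yJ fg; have: g y \in S y :\: nbr S J by apply: gS; rewrite inE yJ.
      by rewrite -fg inE (subsetP (sub_nbr S xJ)) ?fS.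
    move=> x y xI yI /=; case: ifPn => xJ; case: ifPn => yJ.
    + exact: fi.
    + exact: disj.
    + by move/esym/disj => /(_ yJ xI xJ).
    + by apply: gi; rewrite inE ?xJ ?yJ.
  move=> e eI /=; case: ifPn => eJ; first exact: fS.
  by have /setDP[] : g e \in S e :\: nbr S J by apply: gS; rewrite inE eJ.
- have /card_gt0P[v vS] : 0 < #|S e0|.
    by have := h [set e0]; rewrite sub1set cards1 nbr1; apply.
  have [||g gi gS] := IH (fun e => S e :\ v) (I :\ e0).
  + by have := cardsD1 e0 I; rewrite e0I; lia.
  + apply/hallP => K; rewrite subsetD1 => /andP[KI e0K].
    have -> : nbr (fun e => S e :\ v) K = nbr S K :\ v.
      apply/setP => w; rewrite inE; apply/bigcupP/andP.
        by case=> e eK /setDP[wS ->]; split=> //; apply/bigcupP; exists e.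
      by case=> wv /bigcupP[e eK wS]; exists e => //; rewrite inE wv.
    have [->|K0] := eqVneq K set0; first by rewrite cards0.
    have := loose K; rewrite KI K0 /= => /nandP[/negbNE/eqP KE|Kt].
      by move: e0K; rewrite KE e0I.
    have := h K KI; have := cardsD1 v (nbr S K); case: (v \in _); lia.
  exists (fun e => if e == e0 then v else g e).
    have disj y : y \in I -> y != e0 -> v <> g y.
      move=> yI ye vg; have: g y \in S y :\ v by apply: gS; rewrite !inE ye.
      by rewrite -vg !inE eqxx.
    move=> x y xI yI /=; case: eqP => [->|/eqP xe]; case: eqP => [->|/eqP ye] //.
    + by move/disj => /(_ yI ye).
    + by move/esym/disj => /(_ xI xe).
    + by apply: gi; rewrite !inE ?xe ?ye.
  move=> e eI /=; case: eqP => [->//|/eqP ee].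
  by have /setDP[] : g e \in S e :\ v by apply: gS; rewrite !inE ee.
Qed.

(** The number of neighbours is submodular, and Hall's condition for [J :&: K] bounds the overlap
    from below. *)
Lemma tightU S I J K : hall S I -> J \subset I -> K \subset I ->
  #|nbr S J| <= #|J| -> #|nbr S K| <= #|K| ->
  #|nbr S (J :|: K)| <= #|J :|: K|.
Proof.
move=> /hallP h JI KI tJ tK; rewrite nbrU !cardsU.
have: #|J :&: K| <= #|nbr S J :&: nbr S K|.
  apply: leq_trans (h _ (subset_trans (subsetIl _ _) JI)) (subset_leq_card _).
  by rewrite subsetI !nbrS ?subsetIl ?subsetIr.
have := subset_leq_card (subsetIl J K); lia.
Qed.

Lemma hall_aug S I J : hall S I -> hall S J -> #|I| < #|J| ->
  exists2 e, e \in J :\: I & hall S (e |: I).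
Proof.
move=> hI hJ IJ; apply/exists_inP; apply: contraTT IJ.
rewrite negb_exists_in -leqNgt => /forall_inP stuck.
pose P K := (K \subset I) && (#|nbr S K| <= #|K|).
(* [K] is the largest tight subset of [I]; if no element of [J] augments [I],
   then all of them have their neighbours among those of [K]. *)
have [K /maxsetP[/andP[KI tK] Kmax] _] :
    {K | maxset P K & set0 \subset K}.
  by apply: maxset_exists; rewrite /P sub0set nbr0 !cards0.
(* A set [X] violating Hall's condition in [e |: I] contains [e]; then [X :\ e] is tight with the
   same neighbours as [X], and maximality puts it inside [K]. *)
have SK e : e \in J :\: I -> S e \subset nbr S K.
  move=> eJ; have := stuck e eJ; rewrite negb_forall => /existsP[X].
  rewrite negb_imply -ltnNge => /andP[XI Xlt].
  have eX : e \in X.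
    apply: contraLR Xlt => eX; rewrite -leqNgt; apply: (hallP _ _ hI).
    by apply/subsetP => x xX; have := subsetP XI _ xX;
       rewrite !inE; case: eqP => // xe; rewrite -xe xX in eX.
  have X'I : X :\ e \subset I by rewrite subDset.
  have X'lt : #|nbr S (X :\ e)| <= #|nbr S X| by rewrite subset_leq_card ?nbrS ?subsetDl.
  have := cardsD1 e X; rewrite eX => cX.
  have hX := hallP _ _ hI _ X'I.
  have eqX : nbr S (X :\ e) = nbr S X.
    by apply/eqP; rewrite eqEcard nbrS ?subsetDl //=; lia.
  have <- : X :\ e :|: K = K.
    apply: Kmax; last exact: subsetUr.
    rewrite /P subUset X'I KI /=; apply: (tightU hI) => //; lia.
  by rewrite nbrU eqX (subset_trans (sub_nbr S eX)) ?subsetUl.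
(* All neighbours of this part of [J] lie among those of the tight [K]. Hence [J :\: I] is no larger
   than [K :\: J], so no larger than [I :\: J], against [#|I| < #|J|]. *)
have JK : #|(J :\: I) :|: (J :&: K)| <= #|K|.
  apply: leq_trans tK; apply: leq_trans (hallP _ _ hJ _ _) _.
    by rewrite subUset subsetDl subsetIl.
  apply: subset_leq_card; rewrite nbrU subUset (nbrS _ (subsetIr J K)) andbT.
  exact/bigcupsP.
move: JK; rewrite cardsU.
have -> : (J :\: I) :&: (J :&: K) = set0.
  apply/setP => x; rewrite !inE; have := subsetP KI x.
  by case: (x \in K) => [->|_] //; rewrite ?andbF.
have : #|K :\: J| <= #|I :\: J| by rewrite subset_leq_card ?setSD.
rewrite cards0 !cardsD (setIC K) (setIC I).
have := subset_leq_card (subsetIl J I); have := subset_leq_card (subsetIr J I).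
have := subset_leq_card (subsetIr J K); lia.
Qed.

(** Vertices inside [W] serve [I] and vertices outside [W] serve [J], so the two bounds add up. *)
Lemma hallU S I J (W : {set V}) : hall S I -> nbr S I \subset W ->
  (forall K, K \subset J -> #|K| <= #|nbr S K :\: W|) -> hall S (I :|: J).
Proof.
move=> /hallP hI IW hJ; apply/hallP => K KIJ.
have -> : K = (K :&: I) :|: (K :&: J) by rewrite -setIUr; apply/esym/setIidPl.
have dis : nbr S (K :&: I) :&: (nbr S (K :&: J) :\: W) = set0.
  apply/setP => v; rewrite !inE; apply/negP => /and3P[vI vW _].
  by rewrite (subsetP IW) ?(subsetP (nbrS _ (subsetIr K I))) in vW.
have : #|nbr S (K :&: I) :|: (nbr S (K :&: J) :\: W)|
    <= #|nbr S (K :&: I :|: K :&: J)|.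
  by rewrite nbrU subset_leq_card ?setUS ?subsetDl.
have := hI _ (subsetIr K I); have := hJ _ (subsetIr K J).
rewrite !(cardsU (K :&: I)) cardsU dis cards0; lia.
Qed.

(** * The transversal matroid given by supports, its circuits and flats *)

Definition hall_matroid S : matroid E.
Proof.
refine (@Matroid E [set I | hall S I] _ _ _); first by rewrite inE hall0.
- by move=> I J IJ; rewrite !inE; apply: hallS.
- move=> I J; rewrite !inE => hI hJ /(hall_aug hI hJ)[e eJ he].
  by exists e => //; rewrite inE.
Defined.

Lemma hall_indep S I : (I \in indep (hall_matroid S)) = hall S I.
Proof. by rewrite inE. Qed.

(** The set family is dual to the supports: each vertex gives the set of elements supported on it.
    One direction is Hall's theorem; in the other, the matching injects each [J] into its
    neighbours. *)
Lemma hall_transversal S (v0 : V) : transversal_matroid (hall_matroid S).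
Proof.
exists #|V|, (fun i => [set e | enum_val i \in S e]) => I.
rewrite hall_indep; split.
  case/(hall_matching v0) => f fi fS.
  exists (fun e : {e | e \in I} => enum_rank (f (val e))); last first.
    by move=> e; rewrite inE enum_rankK; apply: fS; apply: valP.
  move=> x y /enum_rank_inj/fi xy; apply: val_inj; apply: xy; exact: valP.
case=> phi phi_inj phiA; apply/hallP => J JI.
have -> : J = val @: [set e : {e | e \in I} | val e \in J].
  apply/setP => e; apply/idP/imsetP => [eJ|[x xJ ->]]; last by rewrite inE in xJ.
  by exists (Sub e (subsetP JI _ eJ)); rewrite ?inE.
rewrite card_imset; last exact: val_inj.
have <- : #|(enum_val \o phi) @: [set e : {e | e \in I} | val e \in J]|
    = #|[set e : {e | e \in I} | val e \in J]|.
  by apply: card_imset; apply: inj_comp phi_inj; apply: enum_val_inj.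
apply/subset_leq_card/subsetP => _ /imsetP[e + ->] /=; rewrite inE => eJ.
apply/bigcupP; exists (val e); first by apply/imsetP; exists e; rewrite ?inE.
by have := phiA e; rewrite inE.
Qed.

(** By minimality only [C] itself violates Hall's condition. For [e] in [C], the chain from
    [#|C|.-1] through the neighbours of [C :\ e] to those of [C] then collapses to equalities. *)
Lemma hall_circuit S C : circuit (hall_matroid S) C ->
  [/\ #|C| = #|nbr S C|.+1, forall e, nbr S (C :\ e) = nbr S C
    & forall e, e \in C -> hall S (C :\ e)].
Proof.
case/minsetP; rewrite hall_indep => Cdep Cmin.
have proper_hall J : J \proper C -> hall S J.
  rewrite properEneq => /andP[JneC JC]; apply: contraNT JneC => Jdep.
  by apply/eqP/Cmin; rewrite ?hall_indep.
have Clt : #|nbr S C| < #|C|.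
  move: Cdep; rewrite negb_forall => /existsP[X].
  rewrite negb_imply -ltnNge => /andP[XC]; have [->//|XneC] := eqVneq X C.
  have /proper_hall/hallP/(_ X (subxx _)) : X \proper C by rewrite properEneq XneC.
  lia.
have Ce e : e \in C -> #|C| <= #|nbr S (C :\ e)|.+1.
  move=> eC; have /hallP/(_ _ (subxx _)) := proper_hall _ (properD1 eC).
  by have := cardsD1 e C; rewrite eC; lia.
have Cle e : #|nbr S (C :\ e)| <= #|nbr S C| by rewrite subset_leq_card ?nbrS ?subsetDl.
split=> [|e|e eC]; last exact/proper_hall/properD1.
  have /card_gt0P[e eC] : 0 < #|C| by lia.
  by have := Ce e eC; have := Cle e; lia.
have [eC|eC] := boolP (e \in C); last first.
  by congr (nbr S _); apply/setDidPl; rewrite disjoint_sym disjoints1.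
by apply/eqP; rewrite eqEcard nbrS ?subsetDl //=; have := Ce e eC; lia.
Qed.

(** [I] already fills [W], so adding an [e] supported in [W] would break Hall's condition, whereas
    an element outside a flat can always be added. *)
Lemma hall_flat_mem S F I e (W : {set V}) : flat (hall_matroid S) F ->
  I \subset F -> hall S I -> nbr S I \subset W -> #|W| <= #|I| ->
  S e \subset W -> e \in F.
Proof.
move=> flF IF hI IW WI eW; apply: contraLR WI => eF; rewrite -ltnNge.
have eI : e \notin I by apply: contraNN eF; apply: (subsetP IF).
have : e |: I \in indep (hall_matroid S).
  by apply: flat_indepU1 flF IF _ eF; rewrite hall_indep.
rewrite hall_indep => /hallP/(_ _ (subxx _)).
rewrite cardsU1 eI nbrU nbr1 => h; apply: leq_trans h (subset_leq_card _).
by rewrite subUset eW.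
Qed.

End Hall.

(** * Invariance of cyclic flats under matroid isomorphism *)

Section Transport.
Variables (E E' : finType) (M : matroid E) (N : matroid E') (f : E -> E').
Hypotheses (fbij : bijective f)
  (fM : forall I : {set E}, (f @: I \in indep N) = (I \in indep M)).

Implicit Types A B C : {set E}.

Let finj : injective f := bij_inj fbij.

Lemma imset_bij : bijective (fun A : {set E} => f @: A).
Proof.
case: fbij => g gf fg; exists (fun A : {set E'} => g @: A) => A.
  by rewrite -imset_comp (eq_imset _ gf) imset_id.
by rewrite -imset_comp (eq_imset _ fg) imset_id.
Qed.

Lemma imset_subset A B : (f @: A \subset f @: B) = (A \subset B).
Proof.
apply/idP/idP => [/subsetP AB|]; last exact: imsetS.
by apply/subsetP => x xA; rewrite -(mem_imset _ _ finj); apply: AB; apply: imset_f.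
Qed.

Lemma rank_imset A : rank N (f @: A) = rank M A.
Proof.
rewrite /rank (reindex _ (onW_bij _ imset_bij)) /=.
apply: eq_big => I; first by rewrite fM imset_subset.
by rewrite card_imset.
Qed.

Lemma flat_imset A : flat N (f @: A) = flat M A.
Proof.
have [g gf fg] := fbij.
apply/forallP/forallP => h e.
  by have := h (f e); rewrite mem_imset // -imsetU1 !rank_imset.
by rewrite -[e]fg mem_imset // -imsetU1 !rank_imset.
Qed.

Lemma circuit_imset C : circuit N (f @: C) = circuit M C.
Proof.
apply/minsetP/minsetP => -[]; rewrite fM => Cdep Cmin; split=> // B.
  rewrite -fM -imset_subset => Bdep BC.
  exact/(imset_inj finj)/Cmin.
have [h hK Kh] := imset_bij; rewrite -(Kh B) fM imset_subset => Bdep BC.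
by rewrite (Cmin _ Bdep BC).
Qed.

Lemma cyclic_imset A : cyclic N (f @: A) = cyclic M A.
Proof.
have [h hK Kh] := imset_bij.
apply/cyclicP/cyclicP => cA e.
  rewrite -(mem_imset _ _ finj) => /cA[C]; rewrite -(Kh C).
  by rewrite circuit_imset imset_subset mem_imset // => hC; exists (h C).
case/imsetP => x /cA[C [cC CA xC] ->]; exists (f @: C).
by rewrite circuit_imset imset_subset mem_imset.
Qed.

Lemma cflat_count_bij e : cflat_count N (f e) = cflat_count M e.
Proof.
rewrite /cflat_count -(card_imset _ (bij_inj imset_bij)); congr #|pred_of_set _|.
have [h hK Kh] := imset_bij.
have E_ A : cyclic_flat N (f @: A) && (f e \in f @: A)
   = cyclic_flat M A && (e \in A).
  by rewrite /cyclic_flat flat_imset cyclic_imset mem_imset.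
apply/setP => A; rewrite inE; apply/idP/imsetP => [|[B + ->]].
  by rewrite -{1 2}(Kh A) E_ => hA; exists (h A); rewrite ?inE ?Kh.
by rewrite inE E_.
Qed.

End Transport.

Import Order.LTheory.

(** * The order embedding of the lattice into sets *)

Section Realization.
Variables (d : Order.disp_t) (L : finLatticeType d).
Implicit Types x y z : L.

Definition nonabove x : {set L} := [set m | ~~ (x <= m)%O].

Lemma nonaboveS x y : (nonabove x \subset nonabove y) = (x <= y)%O.
Proof.
apply/subsetP/idP => [/(_ y)|xy m]; rewrite !inE.
  by rewrite lexx; case: (x <= y)%O => // /(_ isT).
by apply: contraNN; apply: le_trans.
Qed.

Lemma nonaboveU x y : nonabove (x `|` y)%O = nonabove x :|: nonabove y.
Proof. by apply/setP => m; rewrite !inE leUx negb_and. Qed.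

Lemma nonabove_inj : injective nonabove.
Proof.
move=> x y xy; apply/eqP.
by rewrite eq_le -!nonaboveS xy subxx.
Qed.

(** Take [z] with the smallest down-set: meeting it with [x] cannot shrink that down-set further.
    [x0] witnesses that [L] is nonempty. *)
Lemma exists_bottom x0 : exists z, forall x, (z <= x)%O.
Proof.
pose below z := [set y | y <= z]%O.
have [z _ zmin] := @arg_minnP _ x0 predT (fun z => #|below z|) isT.
exists z => x; suff: below (z `&` x)%O == below z.
  by move/eqP/setP/(_ z); rewrite !inE lexx lexI => /andP[].
rewrite eqEcard (zmin (z `&` x)%O) ?andbT //.
by apply/subsetP => y; rewrite !inE lexI => /andP[].
Qed.

(** Dually, take [z] in [P] with the largest down-set: joining it with [x] stays in [P] and cannot
    enlarge that down-set. *)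
Lemma exists_greatest (P : pred L) x0 : P x0 ->
  (forall x y, P x -> P y -> P (x `|` y)%O) ->
  exists2 z, P z & forall x, P x -> (x <= z)%O.
Proof.
move=> Px0 PU; pose below z := [set y | y <= z]%O.
have [z Pz zmax] := @arg_maxnP _ x0 P (fun z => #|below z|) Px0.
exists z => // x Px; suff: below z == below (z `|` x)%O.
  by move/eqP/setP/(_ (z `|` x)%O); rewrite !inE lexx leUx => /andP[].
rewrite eqEcard [X in _ && X](zmax (z `|` x)%O (PU _ _ Pz Px)) andbT.
by apply/subsetP => y; rewrite !inE => /le_trans; apply; apply: leUl.
Qed.

(** * The cyclic flats of elements placed on the faces of a simplex *)

Variables (E : finType) (S : E -> {set L}) (e0 : E) (x0 : L).
Implicit Types (A B C G : {set E}) (e : E).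

Definition fiber x : {set E} := [set e | S e == nonabove x].

Definition face x : {set E} := [set e | S e \subset nonabove x].

(* One element [e0] may have an arbitrary support: removing it from a circuit
   does not change the support of the circuit, so it creates no cyclic flat. *)
Hypotheses (fiber_large : forall x, #|nonabove x| < #|fiber x|)
  (S_nonabove : forall e, e != e0 -> exists x, S e = nonabove x).

Let M := hall_matroid S.

Lemma fiber_face x : fiber x \subset face x.
Proof. by apply/subsetP => e; rewrite !inE => /eqP ->. Qed.

Lemma nbr_face x : nbr S (face x) \subset nonabove x.
Proof. by apply/bigcupsP => e; rewrite inE. Qed.

Lemma nbr_fiber x B : B \subset fiber x -> B != set0 -> nbr S B = nonabove x.
Proof.
move=> /subsetP Bx /set0Pn[e eB]; apply/eqP; rewrite eqEsubset; apply/andP; split.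
  by apply/bigcupsP => y /Bx; rewrite inE => /eqP ->.
by have := Bx e eB; rewrite inE => /eqP <-; apply: sub_nbr.
Qed.

Lemma hall_fiber x B : B \subset fiber x -> #|B| <= #|nonabove x| -> hall S B.
Proof.
move=> Bx Bc; apply/hallP => J JB.
have [->|J0] := eqVneq J set0; first by rewrite cards0.
rewrite (nbr_fiber (subset_trans JB Bx)) //.
exact: leq_trans (subset_leq_card JB) Bc.
Qed.

(** Generic elements share the support [nonabove x], so any [#|nonabove x|] of them are independent;
    they serve as a basis of [face x]. *)
Lemma fiber_basis x (A : {set E}) : fiber x \subset A ->
  exists B, [/\ B \subset fiber x, B \subset A, hall S B,
    nbr S B \subset nonabove x & #|B| = #|nonabove x|].
Proof.
move=> xA; have [B Bx Bc] := exists_subset_card (ltnW (fiber_large x)).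
exists B; split=> //; first exact: subset_trans xA.
  by apply: hall_fiber Bx _; rewrite Bc.
exact: subset_trans (nbrS _ (subset_trans Bx (fiber_face x))) (nbr_face x).
Qed.

Lemma rank_face x : rank M (face x) = #|nonabove x|.
Proof.
apply/eqP; rewrite eqn_leq; apply/andP; split.
  apply/bigmax_leqP => I /andP[]; rewrite hall_indep => /hallP/(_ _ (subxx _)) h Ix.
  apply: leq_trans h (subset_leq_card _).
  exact: subset_trans (nbrS _ Ix) (nbr_face x).
have [B [_ Bx hB _ <-]] := fiber_basis (fiber_face x).
by apply: indep_rank; rewrite ?hall_indep.
Qed.

(** An element off the face has a support vertex outside [nonabove x], which extends a basis taken
    from the fiber. *)
Lemma flat_face x : flat M (face x).
Proof.
apply/forallP => e; apply/implyP; rewrite inE rank_face => ex.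
have [B [Bf Bx hB nB Bc]] := fiber_basis (fiber_face x).
have eB : e \notin B by apply: contraNN ex => /(subsetP Bx); rewrite inE.
have -> : #|nonabove x|.+1 = #|e |: B| by rewrite cardsU1 eB Bc.
apply: indep_rank; last by rewrite setUS.
rewrite hall_indep setUC; apply: (hallU hB nB) => K.
rewrite subset1 => /orP[]/eqP ->; last by rewrite cards0.
by rewrite cards1 nbr1 card_gt0 setD_eq0.
Qed.

(** Adding [e] to a fiber basis that avoids [e] creates a circuit, which must pass through [e]
    because the basis is independent. *)
Lemma cyclic_face x : cyclic M (face x).
Proof.
apply/cyclicP => e ex.
have [B Bf Bc] : exists2 B : {set E}, B \subset fiber x :\ e & #|B| = #|nonabove x|.
  apply: exists_subset_card.
  (* The strict inequality in [fiber_large] leaves a basis in the fiber even after [e] is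
     removed. *)
  by have := fiber_large x; rewrite (cardsD1 e (fiber x)); case: (_ \in _) => /=; lia.
have [Bx eB] : B \subset fiber x /\ e \notin B by apply/andP; rewrite -subsetD1.
have eBx : e |: B \subset face x.
  by rewrite subUset sub1set ex (subset_trans Bx (fiber_face x)).
have dep : e |: B \notin indep M.
  rewrite hall_indep; apply/hallP => /(_ _ (subxx _)).
  rewrite cardsU1 eB Bc.
  by have := subset_leq_card (subset_trans (nbrS S eBx) (nbr_face x)); lia.
have [C Cc CeB] := minset_exists (P := fun A => A \notin indep M) dep.
exists C; split=> //; first exact: subset_trans eBx.
have /minsetP[+ _] := Cc; apply: contraNT => eC; rewrite hall_indep.
apply: hallS (hall_fiber Bx _); last by rewrite Bc.
apply/subsetP => y yC; have := subsetP CeB y yC.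
by rewrite !inE; case: eqP => // ye; rewrite -ye yC in eC.
Qed.

(** A basis from the fiber of [x], plus enough of the fiber of [y] to cover
    [nonabove y :\: nonabove x], is independent in [G] and fills the support of the join. *)
Lemma face_join G x y : flat M G -> face x \subset G -> face y \subset G ->
  face (x `|` y)%O \subset G.
Proof.
move=> flG xG yG.
have [A [Af AG hA nA Ac]] := fiber_basis (subset_trans (fiber_face x) xG).
have [B Bf Bc] : exists2 B : {set E}, B \subset fiber y
    & #|B| = #|nonabove y :\: nonabove x|.
  apply: exists_subset_card; apply: leq_trans (ltnW (fiber_large y)).
  exact: subset_leq_card (subsetDl _ _).
have BG : B \subset G by apply: subset_trans Bf (subset_trans (fiber_face y) yG).
have hAB : hall S (A :|: B).
  apply: (hallU hA nA) => K KB.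
  have [->|K0] := eqVneq K set0; first by rewrite cards0.
  rewrite (nbr_fiber (subset_trans KB Bf)) // -Bc.
  exact: subset_leq_card.
(* A common element would force equal supports, and then [B] has size 0. *)
have AB : A :&: B = set0.
  apply/setP => e; rewrite !inE; apply/negP => /andP[eA eB].
  have := subsetP Af e eA; have := subsetP Bf e eB; rewrite !inE => /eqP -> /eqP yx.
  move: Bc; rewrite yx setDv cards0 => /eqP; rewrite cards_eq0 => /eqP B0.
  by rewrite B0 inE in eB.
apply/subsetP => e; rewrite inE nonaboveU => eW.
apply: (hall_flat_mem flG _ hAB _ _ eW); first by rewrite subUset AG.
  rewrite nbrU setUSS //.
  exact: subset_trans (nbrS _ (subset_trans Bf (fiber_face y))) (nbr_face y).
by rewrite [leqRHS]cardsU AB cards0 Ac Bc cardsU cardsD setIC; lia.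
Qed.

Lemma nonabove_bottom z : (forall x, z <= x)%O -> nonabove z = set0.
Proof. by move=> zmin; apply/setP => m; rewrite !inE zmin. Qed.

Lemma circuit_nbr C : circuit M C -> exists x, nbr S C = nonabove x.
Proof.
move=> Cc; have [z zmin] := exists_bottom x0.
have [||x xC xmax] := @exists_greatest [pred x | nonabove x \subset nbr S C] z.
- by rewrite /= nonabove_bottom ?sub0set.
- by move=> x y /= xC yC; rewrite nonaboveU subUset xC.
rewrite /= in xC; exists x; apply/eqP; rewrite eqEsubset xC andbT.
have [_ CD1 _] := hall_circuit Cc.
rewrite -(CD1 e0); apply/bigcupsP => e /setD1P[/S_nonabove[y Sy] eC].
by rewrite Sy nonaboveS xmax //= -Sy sub_nbr.
Qed.

Lemma cyclic_flat_face x : cyclic_flat M (face x).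
Proof. by rewrite /cyclic_flat flat_face cyclic_face. Qed.

(** Take the greatest [x] with [face x] inside [G]. A circuit in [G] has support [nonabove y] and,
    less one element, fills it; so [face y] lies in [G], whence [y <= x] and the circuit lies in
    [face x]. *)
Lemma cyclic_flatE G : cyclic_flat M G -> exists x, face x == G.
Proof.
case/andP=> flG /cyclicP cG; have [z zmin] := exists_bottom x0.
have [||x xG xmax] := @exists_greatest [pred x | face x \subset G] z.
- apply/subsetP => e; rewrite inE nonabove_bottom // => eW.
  (* Elements with empty support are loops, and loops lie in every flat. *)
  by apply: (hall_flat_mem flG (sub0set _) (hall0 S) _ _ eW); rewrite ?nbr0 ?cards0.
- by move=> x y /=; apply: face_join.
rewrite /= in xG; exists x; rewrite eqEsubset xG; apply/subsetP => e /cG[C [Cc CG eC]].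
have [y Cy] := circuit_nbr Cc; have [cC CD1 CI] := hall_circuit Cc.
have /xmax yx : face y \subset G.
  apply/subsetP => f; rewrite inE -Cy => fC.
  apply: (hall_flat_mem flG _ (CI e eC) _ _ fC); last first.
  - by have := cardsD1 e C; rewrite eC; lia.
  - by rewrite CD1.
  - exact: subset_trans (subsetDl _ _) CG.
rewrite inE; apply: subset_trans (sub_nbr S eC) _.
by rewrite Cy nonaboveS.
Qed.

Lemma faceS x y : (face x \subset face y) = (x <= y)%O.
Proof.
apply/idP/idP => [xy|].
  have /card_gt0P[e ex] : 0 < #|fiber x| by apply: leq_ltn_trans (fiber_large x).
  have := subsetP xy e (subsetP (fiber_face x) e ex).
  by move: ex; rewrite !inE => /eqP ->; rewrite nonaboveS.
rewrite -nonaboveS => xy; apply/subsetP => e; rewrite !inE => ex.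
exact: subset_trans xy.
Qed.

Lemma face_inj : injective face.
Proof. by move=> x y xy; apply/eqP; rewrite eq_le -!faceS xy subxx. Qed.

Definition face_cflat x : cflat M := CFlat (cyclic_flat_face x).

Lemma face_cflat_inj : injective face_cflat.
Proof. by move=> x y /(congr1 (@cfset _ _))/face_inj. Qed.

Lemma face_cflat_surj (F : cflat M) : exists x, face_cflat x == F.
Proof. by case: F => F cF; have := cyclic_flatE cF. Qed.

Definition cflat_index (F : cflat M) : L := xchoose (face_cflat_surj F).

Lemma cflat_indexK : cancel cflat_index face_cflat.
Proof. by move=> F; apply/eqP/(xchooseP (face_cflat_surj F)). Qed.

Lemma face_cflatK : cancel face_cflat cflat_index.
Proof. by move=> x; apply: face_cflat_inj; rewrite cflat_indexK. Qed.

Lemma face_cflat_iso : lattice_isomorphism face_cflat.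
Proof.
split; first by exists cflat_index; [apply: face_cflatK | apply: cflat_indexK].
exact: faceS.
Qed.

Lemma cflat_index_iso : lattice_isomorphism cflat_index.
Proof.
split; first by exists face_cflat; [apply: cflat_indexK | apply: face_cflatK].
by move=> F G; rewrite -[in RHS](cflat_indexK F) -[in RHS](cflat_indexK G) [RHS]faceS.
Qed.

Lemma cflat_count_nonabove e :
  cflat_count M e = #|[set x | S e \subset nonabove x]|.
Proof.
rewrite -(card_imset _ face_inj); congr #|pred_of_set _|.
apply/setP => F; rewrite inE; apply/andP/imsetP => [[/cyclic_flatE[x /eqP <-]]|[x + ->]].
  by rewrite inE => ex; exists x; rewrite ?inE.
by rewrite inE => ex; rewrite inE cyclic_flat_face.
Qed.

End Realization.

(** * Generic elements together with two extra ones *)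

Section TwoRealizations.
Variables (d : Order.disp_t) (L : finLatticeType d).
Implicit Types (x y a b : L) (p q : {set L}).

(** The two [inl] elements are the extra ones. Each [nonabove x] gets [#|L|.+1] generic copies, more
    than its size, as [fiber_large] demands. *)
Definition support p q (e : bool + L * 'I_#|L|.+1) : {set L} :=
  match e with
  | inl true => p
  | inl false => q
  | inr (x, _) => nonabove x
  end.

Lemma fiber_support_large p q x : #|nonabove x| < #|fiber (support p q) x|.
Proof.
pose copy i : bool + L * 'I_#|L|.+1 := inr (x, i).
have copy_inj : injective copy by move=> i j [].
apply: (@leq_trans #|copy @: 'I_#|L|.+1|).
  by rewrite card_imset // card_ord ltnS max_card.
by apply/subset_leq_card/subsetP => _ /imsetP[i _ ->]; rewrite inE.
Qed.

(** [inl true] takes the role of [e0]. This allows [p] to be [nonabove a :&: nonabove b], which is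
    no [nonabove x] when [a] and [b] are incomparable. *)
Lemma support_nonabove p y e : e != inl true ->
  exists x, support p (nonabove y) e = nonabove x.
Proof. by case: e => [[]|[x i]] //= _; [exists y | exists x]. Qed.

(** Splits off the generic contribution, which is common to both matroids, in the face sizes as well
    as in the invariant. *)
Lemma sum_support (F : {set L} -> nat) p q :
  \sum_e F (support p q e) =
  F p + F q + \sum_(e : L * 'I_#|L|.+1) F (nonabove e.1).
Proof.
rewrite big_sumType /= big_bool /=; congr (_ + _).
by apply: eq_bigr => -[].
Qed.

Lemma card_face_support p q x :
  #|face (support p q) x| = (p \subset nonabove x) + (q \subset nonabove x)
    + \sum_(e : L * 'I_#|L|.+1) (nonabove e.1 \subset nonabove x).
Proof.
rewrite -(sum_support (fun s => s \subset nonabove x : nat)) -sum1_card big_mkcond.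
by apply: eq_bigr => e _; rewrite inE; case: ifP.
Qed.

(** The forward direction tests the inclusion at [x], which is never in [nonabove x]. *)
Lemma meet_nonaboveS a b x :
  (nonabove a :&: nonabove b \subset nonabove x) = (a <= x)%O || (b <= x)%O.
Proof.
apply/idP/orP => [/subsetP/(_ x)|[]].
- by rewrite !inE lexx -negb_or => h; apply/orP; apply: contraT => /h.
- by rewrite -nonaboveS; apply: subset_trans; apply: subsetIl.
- by rewrite -nonaboveS; apply: subset_trans; apply: subsetIr.
Qed.

End TwoRealizations.

Theorem theorem7p1 (d : Order.disp_t) (L : finLatticeType d)
    (L_not_chain : ~ (forall x y : L, (x <= y)%O \/ (y <= x)%O)) :
  exists (E E' : finType) (M : matroid E) (N : matroid E'),
    [/\ transversal_matroid M /\ transversal_matroid N,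
        ~ matroid_isomorphic M N,
        same_configuration M N &
        lattice_isomorphic (cflat M) L /\ lattice_isomorphic (cflat N) L].
Proof.
have [a [b [ab ba]]] : exists a b : L, ~~ (a <= b)%O /\ ~~ (b <= a)%O.
  have [/existsP[a /existsP[b /andP[]]]|h] :=
    boolP [exists a : L, exists b : L, ~~ (a <= b)%O && ~~ (b <= a)%O].
    by exists a, b.
  case: L_not_chain => x y; apply/orP; apply: contraNT h.
  by rewrite negb_or => xy; apply/existsP; exists x; apply/existsP; exists y.
pose p := nonabove a :&: nonabove b; pose q := nonabove (a `|` b)%O.
pose S := support p q; pose T := support (nonabove a) (nonabove b).
pose largeS := fiber_support_large p q.
pose largeT := fiber_support_large (nonabove a) (nonabove b).
have hS := @support_nonabove _ L p (a `|` b)%O.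
have hT := @support_nonabove _ L (nonabove a) b.
exists _, _, (hall_matroid S), (hall_matroid T); split.
- by split; apply: hall_transversal.
- case=> f fbij fM.
  (* Squares are essential: the plain sums agree, as [#|A :|: B| + #|A :&: B| = #|A| + #|B|]. *)
  have : \sum_e cflat_count (hall_matroid S) e ^ 2
       = \sum_e cflat_count (hall_matroid T) e ^ 2.
    rewrite [RHS](reindex _ (onW_bij _ fbij)).
    by apply: eq_bigr => e _; rewrite (cflat_count_bij fbij fM).
  pose c (s : {set L}) := #|[set x : L | s \subset nonabove x]|.
  under eq_bigr do rewrite (cflat_count_nonabove a largeS hS) -/(c _).
  under [RHS]eq_bigr do rewrite (cflat_count_nonabove a largeT hT) -/(c _).
  rewrite !(sum_support (fun s => c s ^ 2)) => /addIn.
  pose A := [set x | a <= x]%O; pose B := [set x | b <= x]%O.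
  have -> : c p = #|A :|: B|.
    by apply: eq_card => x; rewrite !inE meet_nonaboveS.
  have -> : c q = #|A :&: B| by apply: eq_card => x; rewrite !inE nonaboveS leUx.
  have -> : c (nonabove a) = #|A| by apply: eq_card => x; rewrite !inE nonaboveS.
  have -> : c (nonabove b) = #|B| by apply: eq_card => x; rewrite !inE nonaboveS.
  have ltA : #|A :&: B| < #|A|.
    apply/proper_card/properP; split; first exact: subsetIl.
    by exists a; rewrite !inE lexx ?(negbTE ba).
  have ltB : #|A :&: B| < #|B|.
    apply/proper_card/properP; split; first exact: subsetIr.
    by exists b; rewrite !inE lexx ?(negbTE ab).
  (* With [u = #|A :&: B|], the two sums of squares differ by [2 (#|A| - u) (#|B| - u)], which is
     positive. *)
  by rewrite cardsU; nia.
(* The isomorphism matches the faces with the same [x]; both have rank [#|nonabove x|]. *)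
- split=> //; exists (face_cflat largeT \o cflat_index a largeS hS).
    have [bS mS] := cflat_index_iso a largeS hS.
    have [bT mT] := face_cflat_iso a largeT hT.
    by split; [apply: bij_comp | move=> x y; rewrite /= mT mS].
  move=> F; have /= FE := congr1 (@cfset _ _) (cflat_indexK a largeS hS F).
  rewrite -[in RHS]FE /=; split; last by rewrite -FE !rank_face.
  (* Only the extra elements can differ: the disjunction and the conjunction of [a <= x] and
     [b <= x] together count as much as the two conditions themselves. *)
  rewrite !card_face_support meet_nonaboveS !nonaboveS leUx.
  by congr (_ + _); case: (a <= _)%O; case: (b <= _)%O.
- split; first by exists (cflat_index a largeS hS); apply: cflat_index_iso.
  by exists (cflat_index a largeT hT); apply: cflat_index_iso.
Qed.
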